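(* Let $\mathbb{K}$ be a field, let $A$, $B$ and $D$ be natural evolution algebras over $\mathbb{K}$, and suppose that $D$ is indecomposable with balance $\operatorname{b}(D)>1$. Let $n$ be a (positive) divisor of $\operatorname{b}(D)$. If $A\otimes C_n\cong B\otimes C_n$ relative to $C_n$ (in the category of natural evolution algebras), then $A\otimes D\cong B\otimes D$ relative to $D$ (in the same category).
   Context: An evolution algebra over $\mathbb{K}$ is a finite-dimensional (not necessarily associative) $\mathbb{K}$-algebra admitting a natural basis, i.e. a basis $\{e_1,\dots,e_n\}$ with $e_ie_j=0$ for $i\neq j$; it is non-degenerate if it has such a basis with all $e_i^2\ne0$. A natural evolution algebra is a non-degenerate evolution algebra $X$ with a fixed decomposition $X=\bigoplus_{i=1}^n A_i$ into one-dimensional subspaces (lines) with $A_iA_j=0$ for $i\ne j$; choosing a nonzero vector in each line gives a natural basis, so we write $X=\bigoplus_i\mathbb{K}b_i$. Morphisms of natural evolution algebras are $\mathbb{K}$-algebra homomorphisms sending each line isomorphically onto a line of the target. The tensor product $\bigoplus_i\mathbb{K}a_i\otimes\bigoplus_r\mathbb{K}c_r$ has lines $\mathbb{K}(a_i\otimes c_r)$, with $(a_i\otimes c_r)^2=a_i^2\otimes c_r^2$. The cyclic algebra is $C_n=\mathbb{K}c_0\oplus\dots\oplus\mathbb{K}c_{n-1}$ with $c_i^2=c_{i+1}$ (indices mod $n$) and $c_ic_j=0$ for $i\neq j$. For natural evolution algebras $A,B$ and $C=\bigoplus_r\mathbb{K}c_r$, $A\otimes C$ and $B\otimes C$ are isomorphic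 relative to $C$ if there is an isomorphism $\varphi\colon A\otimes C\to B\otimes C$ such that for every natural basis vector $c_r$ of $C$ there is a linear map $\psi_r\colon A\to B$ with $\varphi(a\otimes c_r)=\psi_r(a)\otimes c_r$ for all $a\in A$. $D=\bigoplus_r\mathbb{K}d_r$ is indecomposable if it is nonzero and is not a direct sum of two nonzero ideals that are evolution algebras. The graph $\Gamma(D)$ is the directed graph whose vertices are the $d_r$, with an edge $(d_r,d_s)$ whenever the coefficient of $d_s$ in $d_r^2$ is nonzero. A path in a directed graph is a sequence $(v_0,e_1,v_1,\dots,e_n,v_n)$, $n\ge 0$, of vertices and edges where each $e_i$ is traversed either forwards ($e_i=(v_{i-1},v_i)$) or backwards ($e_i=(v_i,v_{i-1})$); its balance is the number of forward steps minus the number of backward steps (a loop may be traversed in either direction, contributing $+1$ or $-1$ accordingly). A cycle is a path with $v_0=v_n$. The balance $\operatorname{b}(D)$ is the gcd of the absolute values of the balances of all cycles of $\Gamma(D)$. *)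

(* Defs.v *)
From HB Require Import structures.
From mathcomp Require Import all_boot all_order all_algebra.
From mathcomp Require Import boolp classical_sets.

Set Implicit Arguments.
Unset Strict Implicit.
Unset Printing Implicit Defensive.

Import Order.TTheory GRing.Theory Num.Theory.
Local Open Scope ring_scope.

Lemma bilinearZl (K : fieldType) (U V W : vectType K)
    (f : {bilinear U -> V -> W}) k x y : f (k *: x) y = k *: f x y.
Proof. exact: linearZl_LR. Qed.

Lemma bilinearZr (K : fieldType) (U V W : vectType K)
    (f : {bilinear U -> V -> W}) k x y : f x (k *: y) = k *: f x y.
Proof. exact: linearZr_LR. Qed.

Section NaturalBasis.
Variables (K : fieldType) (V : vectType K) (mul : V -> V -> V).

(* As [b] is duplicate-free when it is a basis, [x != y] amounts to distinct
   indices. *)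
Definition natural_basis (U : {vspace V}) (b : seq V) : Prop :=
  basis_of U b /\ {in b &, forall x y, x != y -> mul x y = 0}.

Definition nondegenerate_evolution : Prop :=
  exists2 b : seq V, natural_basis fullv b & {in b, forall x, mul x x != 0}.

End NaturalBasis.

Record natEvAlg (K : fieldType) := NatEvAlg {
  carrier :> vectType K;
  emul : {bilinear carrier -> carrier -> carrier};
  lindex : finType;
  line : lindex -> {vspace carrier};
  dim_line : forall i, \dim (line i) = 1%N;
  line_direct : directv (\sum_i line i)%VS;
  line_full : (\sum_i line i)%VS = fullv;
  line_orth : forall i j, i != j ->
    {in line i & line j, forall x y, emul x y = 0};
  line_nondegenerate : nondegenerate_evolution emul
}.

Arguments emul {K n} : rename.
Arguments lindex {K} n : rename.
Arguments line {K} n : rename.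

Section Morphisms.
Variables (K : fieldType) (X Y : natEvAlg K).

Definition nea_morphism (f : 'Hom(X, Y)) : Prop :=
  (forall x y, f (emul x y) = emul (f x) (f y)) /\
  (forall i, {in line X i &, injective f} /\
             exists j, (f @: line X i)%VS = line Y j).

End Morphisms.

Definition nea_iso (K : fieldType) (X Y : natEvAlg K) (f : 'Hom(X, Y)) : Prop :=
  nea_morphism f /\
  exists g : 'Hom(Y, X), [/\ nea_morphism g, cancel f g & cancel g f].

Section BasisVectors.
Variables (K : fieldType) (X : natEvAlg K).

(* Some nonzero vector of the line; another choice only rescales it, which does
   not affect [edge] below. *)
Definition bvec (i : lindex X) : X := vpick (line X i).

Definition btuple : #|lindex X|.-tuple X :=
  [tuple bvec (enum_val k) | k < #|lindex X|].

Definition bcoef (i : lindex X) (x : X) : K := coord btuple (enum_rank i) x.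

Lemma bvec_neq0 i : bvec i != 0.
Proof. by rewrite vpick0 -dimv_eq0 dim_line. Qed.

Lemma bvec_line i : line X i = <[bvec i]>%VS.
Proof.
apply/esym/eqP; rewrite eqEdim -memvE memv_pick /=.
by rewrite dim_vline bvec_neq0 dim_line.
Qed.

Lemma card_lindex : \dim (fullv : {vspace X}) = #|lindex X|.
Proof.
rewrite -line_full (directvP (line_direct X)) /=.
by under eq_bigr do rewrite dim_line; rewrite sum1_card.
Qed.

Lemma btuple_basis : basis_of fullv btuple.
Proof.
rewrite basisEdim size_tuple card_lindex leqnn andbT -line_full.
apply/subv_sumP => i _; rewrite bvec_line -memvE.
apply: memv_span; apply/mapP; exists (enum_rank i); first by rewrite mem_enum.
by rewrite enum_rankK.
Qed.

Lemma bcoef_sum x : x = \sum_i bcoef i x *: bvec i.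
Proof.
rewrite {1}(coord_basis btuple_basis (memvf x)) (reindex enum_rank) /=.
  by apply: eq_bigr => i _; congr (_ *: _); rewrite nth_mktuple enum_rankK.
by apply: onW_bij; apply: enum_rank_bij.
Qed.

Lemma bvec_orth i j : i != j -> emul (bvec i) (bvec j) = 0.
Proof. by move=> ij; apply: (line_orth ij); apply: memv_pick. Qed.

End BasisVectors.

Section Build.
Variables (K : fieldType) (V : vectType K) (I : finType) (b : I -> V).
Hypothesis dV : \dim (fullv : {vspace V}) = #|I|.
Hypothesis bV : forall x : V, x \in (\sum_i <[b i]>)%VS.

Lemma lines_full : (\sum_i <[b i]>)%VS = fullv.
Proof. by apply/eqP; rewrite eqEsubv subvf; apply/subvP=> x _; exact: bV. Qed.

Lemma lines_dim i : \dim <[b i]>%VS = 1%N.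
Proof.
have /leqifP : (\sum_i \dim <[b i]>%VS <= \sum_(i : I) 1
    ?= iff [forall i, \dim <[b i]>%VS == 1])%N.
  by apply: leqif_sum => j _; rewrite dim_vline; split=> //; case: (_ != 0).
rewrite sum1_card; case: ifP => [/forallP/(_ i)/eqP //|_].
rewrite ltnNge -dV -lines_full; case/negP.
exact: dimv_leq_sum.
Qed.

Lemma lines_direct : directv (\sum_i <[b i]>)%VS.
Proof.
rewrite directvE /= lines_full dV.
by under eq_bigr do rewrite lines_dim; rewrite sum1_card.
Qed.

End Build.

Section Tensor.
Variables (K : fieldType) (A C : natEvAlg K).

(* The tensor product of the underlying spaces, in coordinates relative to the
   library's bases of A and C (which need not be natural). *)
Definition tensor_space : vectType K :=
  'M[K]_(\dim (fullv : {vspace A}), \dim (fullv : {vspace C})).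

Definition tens (a : A) (c : C) : tensor_space :=
  \matrix_(i, j) (coord (vbasis fullv) i a * coord (vbasis fullv) j c).

Lemma tens_is_bilinear : bilinear_for *:%R *:%R tens.
Proof.
split=> [c|a] k x y; apply/matrixP=> i j; rewrite !mxE linearP /=.
  by rewrite mulrDl mulrA.
by rewrite mulrDr mulrCA.
Qed.
HB.instance Definition _ := bilinear_isBilinear.Build K A C tensor_space
  *:%R *:%R tens tens_is_bilinear.

Lemma tens_delta (i : 'I_(\dim (fullv : {vspace A})))
    (j : 'I_(\dim (fullv : {vspace C}))) :
  tens (vbasis fullv)`_i (vbasis fullv)`_j = delta_mx i j.
Proof.
apply/matrixP=> k l; rewrite !mxE.
rewrite !coord_free ?(basis_free (vbasisP _)) //.
by rewrite (eq_sym k) (eq_sym l) -natrM mulnb.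
Qed.

(* (a (x) c)(a' (x) c') = aa' (x) cc' extended bilinearly: see [tens_mul]. *)
Definition tensor_mul (x y : tensor_space) : tensor_space :=
  \sum_i \sum_j \sum_k \sum_l (x i j * y k l) *:
    tens (emul (vbasis fullv)`_i (vbasis fullv)`_k)
         (emul (vbasis fullv)`_j (vbasis fullv)`_l).

Lemma tensor_mul_is_bilinear : bilinear_for *:%R *:%R tensor_mul.
Proof.
split=> [y|x] k u v /=; rewrite /tensor_mul;
  do 4! (rewrite scaler_sumr -big_split; apply: eq_bigr => ? _ /=);
  rewrite !mxE scalerA -scalerDl; congr (_ *: _).
  by rewrite mulrDl mulrA.
by rewrite mulrDr mulrCA.
Qed.
HB.instance Definition _ := bilinear_isBilinear.Build K
  tensor_space tensor_space tensor_space *:%R *:%R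
  tensor_mul tensor_mul_is_bilinear.

Lemma tens_mul a a' c c' :
  tensor_mul (tens a c) (tens a' c') = tens (emul a a') (emul c c').
Proof.
rewrite {2}(coord_vbasis (memvf a)) {2}(coord_vbasis (memvf a')).
rewrite {2}(coord_vbasis (memvf c)) {2}(coord_vbasis (memvf c')).
rewrite (linear_sumlz emul) (linear_sumlz tens) /tensor_mul.
apply: eq_bigr => i _; rewrite (linear_sumlz emul) (linear_sumr tens).
apply: eq_bigr => j _; rewrite (linear_sumr emul) (linear_sumlz tens).
apply: eq_bigr => k _; rewrite (linear_sumr emul) (linear_sumr tens).
apply: eq_bigr => l _; rewrite !mxE.
rewrite !(bilinearZl, bilinearZr) /=.
by rewrite !scalerA; congr (_ *: _);
rewrite -!mulrA; congr (_ * _); rewrite mulrCA.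
Qed.

Lemma tens_neq0 a c : a != 0 -> c != 0 -> tens a c != 0.
Proof.
have nz (X : natEvAlg K) (x : X) :
    x != 0 -> exists i, coord (vbasis fullv) i x != 0.
  move=> x0; apply/existsP; apply: contraR x0; rewrite negb_exists => /forallP x0.
  rewrite (coord_vbasis (memvf x)) big1 // => i _.
  by have /negPn/eqP-> := x0 i; rewrite scale0r.
move=> /nz[i ai] /nz[j cj]; apply: contraNneq (mulf_neq0 ai cj) => /matrixP/(_ i j).
by rewrite !mxE => ->.
Qed.

Lemma tens_span (b : seq A) (c : seq C) (U : {vspace tensor_space}) :
  <<b>>%VS = fullv -> <<c>>%VS = fullv ->
  {in b & c, forall x y, tens x y \in U} -> (fullv <= U)%VS.
Proof.
move=> sb sc bcU; apply/subvP=> x _; rewrite (matrix_sum_delta x).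
apply: memv_suml => i _; apply: memv_suml => j _; apply: memvZ.
rewrite -tens_delta.
have: (vbasis {:A})`_i \in <<in_tuple b>>%VS by rewrite /= sb memvf.
have: (vbasis {:C})`_j \in <<in_tuple c>>%VS by rewrite /= sc memvf.
move=> /coord_span-> /coord_span->.
rewrite (linear_sumlz tens); apply: memv_suml => k _.
rewrite (linear_sumr tens); apply: memv_suml => l _.
rewrite !(bilinearZl, bilinearZr) /=; do 2! apply: memvZ.
by apply: bcU; rewrite mem_nth.
Qed.

Lemma dim_tensor :
  \dim (fullv : {vspace tensor_space}) =
    (\dim (fullv : {vspace A}) * \dim (fullv : {vspace C}))%N.
Proof. by rewrite dimvf. Qed.

Lemma tensor_nondegenerate : nondegenerate_evolution tensor_mul.
Proof.
have [b [bb bo] bn] := line_nondegenerate A.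
have [c [cb co] cn] := line_nondegenerate C.
exists [seq tens x y | x <- b, y <- c]; last first.
  by move=> _ /allpairsP[[x y] [/= xb yc ->]]; rewrite tens_mul tens_neq0 ?bn ?cn.
split.
  rewrite basisEdim size_allpairs dim_tensor -(size_basis (X := in_tuple b) bb)
    -(size_basis (X := in_tuple c) cb).
  rewrite leqnn andbT; apply: (tens_span (span_basis bb) (span_basis cb)).
  by move=> x y xb yc; apply/memv_span/allpairs_f.
move=> _ _ /allpairsP[[x y] [/= xb yc ->]] /allpairsP[[x' y'] [/= xb' yc' ->]].
move=> ne; rewrite tens_mul; have [xx'|/bo->//] := eqVneq x x'.
  have [yy'|/co->//] := eqVneq y y'; last by rewrite (linear0r tens).
  by rewrite xx' yy' eqxx in ne.
by rewrite (linear0l tens).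
Qed.

Definition tensor_bvec (p : lindex A * lindex C) : tensor_space :=
  tens (bvec p.1) (bvec p.2).

Lemma tensor_dim_card :
  \dim (fullv : {vspace tensor_space}) = #|{: lindex A * lindex C}|.
Proof. by rewrite dim_tensor card_prod !card_lindex. Qed.

Lemma tensor_bvec_span (x : tensor_space) :
  x \in (\sum_p <[tensor_bvec p]>)%VS.
Proof.
have sA := span_basis (btuple_basis A); have sC := span_basis (btuple_basis C).
apply: subvP (memvf x); apply: (tens_span sA sC).
move=> _ _ /mapP[i _ ->] /mapP[j _ ->].
by apply: subvP (memv_line _); apply: (sumv_sup (enum_val i, enum_val j)).
Qed.

Lemma tensor_orth p q : p != q ->
  {in <[tensor_bvec p]>%VS & <[tensor_bvec q]>%VS,
    forall x y, tensor_mul x y = 0}.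
Proof.
move=> pq _ _ /vlineP[k ->] /vlineP[l ->].
rewrite (bilinearZl tensor_mul) (bilinearZr tensor_mul) /= tens_mul.
case: p q pq => [i r] [j s] /=; rewrite xpair_eqE negb_and => /orP[] /bvec_orth->.
  by rewrite (linear0l tens) !scaler0.
by rewrite (linear0r tens) !scaler0.
Qed.

Definition tensor : natEvAlg K := @NatEvAlg K tensor_space tensor_mul
  (lindex A * lindex C)%type (fun p => <[tensor_bvec p]>%VS)
  (lines_dim tensor_dim_card tensor_bvec_span)
  (lines_direct tensor_dim_card tensor_bvec_span)
  (lines_full tensor_bvec_span) tensor_orth tensor_nondegenerate.

End Tensor.

Section Cyclic.
Variables (K : fieldType) (n : nat).

Definition cyclic_vec (i : 'I_n) : 'rV[K]_n := delta_mx 0 i.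

(* [ordS i] is i + 1 modulo n. *)
Definition cyclic_mul (x y : 'rV[K]_n) : 'rV[K]_n :=
  \sum_i (x 0 i * y 0 i) *: cyclic_vec (ordS i).

Lemma cyclic_mul_is_bilinear : bilinear_for *:%R *:%R cyclic_mul.
Proof.
split=> [y|x] k u v /=; rewrite /cyclic_mul scaler_sumr -big_split;
  apply: eq_bigr => i _ /=; rewrite !mxE scalerA -scalerDl; congr (_ *: _).
  by rewrite mulrDl mulrA.
by rewrite mulrDr mulrCA.
Qed.
HB.instance Definition _ := bilinear_isBilinear.Build K
  'rV[K]_n 'rV[K]_n 'rV[K]_n *:%R *:%R cyclic_mul cyclic_mul_is_bilinear.

Lemma cyclic_sqr i : cyclic_mul (cyclic_vec i) (cyclic_vec i) = cyclic_vec (ordS i).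
Proof.
rewrite /cyclic_mul (bigD1 i) //= big1 => [|j ji].
  by rewrite !mxE !eqxx mulr1 scale1r addr0.
by rewrite !mxE (negPf ji) andbF mul0r scale0r.
Qed.

Lemma cyclic_vec_orth i j : i != j ->
  cyclic_mul (cyclic_vec i) (cyclic_vec j) = 0.
Proof.
move=> ij; rewrite /cyclic_mul big1 // => k _; rewrite !mxE /=.
case: (eqVneq k i) => [->|_]; last by rewrite mul0r scale0r.
by rewrite (negPf ij) mulr0 scale0r.
Qed.

Lemma cyclic_vec_neq0 i : cyclic_vec i != 0.
Proof.
apply/eqP=> /matrixP/(_ 0 i)/eqP; rewrite !mxE !eqxx; exact/negP/oner_neq0.
Qed.

Lemma dim_cyclic : \dim (fullv : {vspace 'rV[K]_n}) = #|'I_n|.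
Proof. by rewrite dimvf card_ord /= [LHS]mul1n. Qed.

Lemma cyclic_vec_span (x : 'rV[K]_n) : x \in (\sum_i <[cyclic_vec i]>)%VS.
Proof.
rewrite (row_sum_delta x); apply: memv_suml => i _; apply: memvZ.
by apply: subvP (memv_line _); apply: (sumv_sup i).
Qed.

Lemma cyclic_orth i j : i != j ->
  {in <[cyclic_vec i]>%VS & <[cyclic_vec j]>%VS,
    forall x y, cyclic_mul x y = 0}.
Proof.
move=> ij _ _ /vlineP[k ->] /vlineP[l ->].
by rewrite (bilinearZl cyclic_mul) (bilinearZr cyclic_mul) /=
  cyclic_vec_orth // !scaler0.
Qed.

Lemma cyclic_nondegenerate : nondegenerate_evolution cyclic_mul.
Proof.
exists [seq cyclic_vec i | i <- enum 'I_n]; last first.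
  by move=> _ /mapP[i _ ->]; rewrite cyclic_sqr cyclic_vec_neq0.
split.
  rewrite basisEdim size_map -cardT dim_cyclic leqnn andbT.
  apply/subvP=> x _; apply: subvP (cyclic_vec_span x); apply/subv_sumP=> i _.
  by rewrite -memvE; apply/memv_span/map_f; rewrite mem_enum.
move=> _ _ /mapP[i _ ->] /mapP[j _ ->] ij; apply: cyclic_vec_orth.
by apply: contraNneq ij => ->.
Qed.

Definition cyclic_alg : natEvAlg K := @NatEvAlg K 'rV[K]_n cyclic_mul
  'I_n (fun i => <[cyclic_vec i]>%VS)
  (lines_dim dim_cyclic cyclic_vec_span)
  (lines_direct dim_cyclic cyclic_vec_span)
  (lines_full cyclic_vec_span) cyclic_orth cyclic_nondegenerate.

End Cyclic.

Definition iso_relative (K : fieldType) (A B C : natEvAlg K) : Prop :=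
  exists phi : 'Hom(tensor A C, tensor B C), nea_iso phi /\
    forall (r : lindex C) (c : C), c \in line C r -> c != 0 ->
      exists psi : 'Hom(A, B), forall a : A, phi (tens a c) = tens (psi a) c.

Section Indecomposable.
Variables (K : fieldType) (D : natEvAlg K).

Definition ideal (U : {vspace D}) : Prop :=
  forall x u, u \in U -> emul x u \in U /\ emul u x \in U.

(* For the product induced on [U]; closure under it is part of [ideal]. *)
Definition evolution_subspace (U : {vspace D}) : Prop :=
  exists b : seq D, natural_basis emul U b.

Definition indecomposable : Prop :=
  ({:D} != 0)%VS /\
  ~ exists U V : {vspace D},
      [/\ (U != 0)%VS /\ (V != 0)%VS,
          ideal U /\ ideal V,
          evolution_subspace U /\ evolution_subspace V,
          (U + V)%VS = fullv & directv (U + V)].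

End Indecomposable.

Section Balance.
Variables (K : fieldType) (D : natEvAlg K).

Definition edge (r s : lindex D) : bool :=
  bcoef s (emul (bvec r) (bvec r)) != 0.

(* A path from v_0 is the sequence of its steps (forward?, v_i), i >= 1. An edge
   is determined by its endpoints, and the boolean tells its direction, also
   for a loop. *)
Fixpoint is_path (v : lindex D) (p : seq (bool * lindex D)) : bool :=
  if p is (fwd, w) :: p' then
    (if fwd then edge v w else edge w v) && is_path w p'
  else true.

Definition path_balance (p : seq (bool * lindex D)) : int :=
  \sum_(s <- p) (if s.1 then 1 else -1).

Definition is_cycle (v : lindex D) (p : seq (bool * lindex D)) : bool :=
  is_path v p && (last v [seq s.2 | s <- p] == v).

Definition cycle_balances : set nat :=
  [set m | exists v p, is_cycle v p /\ m = `|path_balance p|%N].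

End Balance.

(* The gcd of a possibly infinite set of naturals; it is 0 on [set 0]. *)
Definition is_gcd (S : set nat) (g : nat) : Prop :=
  (forall m, S m -> (g %| m)%N) /\
  (forall d, (forall m, S m -> (d %| m)%N) -> (d %| g)%N).

Lemma is_gcd_exists S : exists g, is_gcd S g.
Proof.
case: (pselect (exists2 k, S k & (0 < k)%N)) => [[k Sk k0]|S0]; last first.
  exists 0%N; split=> [m Sm|d _]; last exact: dvdn0.
  by case: m Sm => // m Sm; case: S0; exists m.+1.
pose P (d : 'I_k.+1) := `[< forall m, S m -> (d %| m)%N >].
exists (\big[lcmn/1%N]_(d < k.+1 | P d) d); split=> [m Sm|d dS].
  by apply/dvdn_biglcmP => d /asboolP; apply.
have dk : (d < k.+1)%N by rewrite ltnS dvdn_leq // dS.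
by apply: (biglcmn_sup (Ordinal dk)) => //; apply/asboolP.
Qed.

Definition gcd_set (S : set nat) : nat := xget 0%N (is_gcd S).

Lemma gcd_setP S : is_gcd S (gcd_set S).
Proof. by have [g Sg] := is_gcd_exists S; apply: (xgetPex 0%N); exists g. Qed.

Definition balance (K : fieldType) (D : natEvAlg K) : nat :=
  gcd_set (cycle_balances D).

(* Main.v *)
(** As every cycle of [Γ(D)] has balance divisible by [n], counting forward minus
    backward steps along paths from a base point of each connected component
    grades the vertices by [Z/n], each edge raising the degree by one. A relative
    isomorphism [A ⊗ C_n -> B ⊗ C_n] is a family of linear bijections [psi i]
    permuting the lines and satisfying [psi (i+1) (a a') = psi i a * psi i a'].
    Hence [a ⊗ d_r |-> psi (deg r) a ⊗ d_r] is multiplicative: only the [d_s] with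
    [deg s = deg r + 1] occur in [d_r ^ 2]. *)

From HB Require Import structures.
Require Import Defs.
From mathcomp Require Import all_boot all_algebra.
From mathcomp Require Import boolp.

Set Implicit Arguments.
Unset Strict Implicit.
Unset Printing Implicit Defensive.

Import GRing.Theory.
Local Open Scope ring_scope.

(** * Balances of paths and the grading of the vertices by residues modulo [n] *)

Section Degree.
Variables (K : fieldType) (D : natEvAlg K).
Implicit Types (u v w : lindex D) (p q : seq (bool * lindex D)).

Definition path_end v p : lindex D := last v [seq s.2 | s <- p].

Lemma is_path_cat v p q :
  is_path v (p ++ q) = is_path v p && is_path (path_end v p) q.
Proof. by elim: p v => //= -[f w] p IH v /=; rewrite IH andbA. Qed.

Lemma path_end_cat v p q : path_end v (p ++ q) = path_end (path_end v p) q.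
Proof. by rewrite /path_end map_cat last_cat. Qed.

Lemma path_balance_cat p q :
  path_balance (p ++ q) = path_balance p + path_balance q.
Proof. by rewrite /path_balance big_cat. Qed.

Lemma path_balance_cons f v p :
  path_balance ((f, v) :: p) = (if f then 1 else -1) + path_balance p.
Proof. by rewrite /path_balance big_cons. Qed.

Lemma path_balance1 f v : path_balance [:: (f, v)] = if f then 1 else -1.
Proof. by rewrite /path_balance big_seq1. Qed.

(** Reversal lets two paths from a common base point be glued into a cycle whose balance is a
    difference of balances. *)
Lemma path_reverse v p : is_path v p ->
  exists q, [/\ is_path (path_end v p) q, path_end (path_end v p) q = v
              & path_balance q = - path_balance p].
Proof.
elim: p v => [|[f w] p IH] v /=.
  by exists [::]; split; rewrite // /path_balance big_nil oppr0.
case/andP=> e /IH[q [qp qe qb]]; exists (q ++ [:: (~~ f, v)]).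
rewrite is_path_cat path_end_cat path_balance_cat path_balance1 path_balance_cons.
have -> : path_end v ((f, w) :: p) = path_end w p by [].
rewrite qp qe qb; split=> //=; first by case: f e => /= ->.
by rewrite opprD addrC; case: f {e} => //=; rewrite opprK.
Qed.

Lemma dvd_cycle_balance v p :
  is_path v p -> path_end v p = v -> (balance D %| `|path_balance p|)%N.
Proof.
move=> vp pv; have [dvd _] := gcd_setP (cycle_balances D).
by apply: dvd; exists v, p; split=> //; apply/andP; split=> //; apply/eqP.
Qed.

(** The underlying undirected graph: its [root] supplies one base point per component, and its
    [connect] amounts to joining by paths with backward steps allowed. *)
Definition adjacent v w := edge v w || edge w v.

Lemma adjacent_connect_sym : connect_sym adjacent.
Proof. by apply: sym_connect_sym => v w; rewrite /adjacent orbC. Qed.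

Lemma connect_is_path v w :
  connect adjacent v w -> exists p, is_path v p /\ path_end v p = w.
Proof.
case/connectP=> s; elim: s v => [|u s IH] v /=; first by move=> _ ->; exists [::].
case/andP=> vu /IH{}IH /IH[p [up pw]].
case/orP: vu => e; [exists ((true, u) :: p)|exists ((false, u) :: p)];
  by rewrite /= e up; split.
Qed.

(** Take for [h v] the balance of a chosen path to [v] from the root of its component. For an edge
    from [v] to [w], the path to [v], the edge, and the reversed path to [w] form a cycle at the
    root, of balance [h v + 1 - h w]. *)
Lemma exists_potential : exists h : lindex D -> int,
  forall v w, edge v w -> ((balance D)%:Z %| h v + 1 - h w)%Z.
Proof.
have /boolp.choice[P Pr] v : exists p,
    is_path (fingraph.root adjacent v) p /\
    path_end (fingraph.root adjacent v) p = v.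
  by apply: connect_is_path; rewrite adjacent_connect_sym connect_root.
exists (fun v => path_balance (P v)) => v w e.
have rvw : fingraph.root adjacent v = fingraph.root adjacent w.
  apply/eqP; rewrite root_connect ?connect1 //; last exact: adjacent_connect_sym.
  by rewrite /adjacent e.
have [[vp ve] [wp we]] := (Pr v, Pr w).
have [q [qp qe qb]] := path_reverse wp; rewrite we -rvw in qp qe.
have -> : path_balance (P v) + 1 - path_balance (P w) =
    path_balance (P v ++ (true, w) :: q).
  by rewrite path_balance_cat path_balance_cons qb addrA.
apply: (@dvd_cycle_balance (fingraph.root adjacent v)).
  by rewrite is_path_cat vp ve /= e.
by rewrite path_end_cat ve.
Qed.

(** The degree is the potential reduced modulo [n]; remainders are nonnegative, so [absz] loses
    nothing. *)
Lemma exists_degree n : (0 < n)%N -> (n %| balance D)%N ->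
  exists deg : lindex D -> 'I_n, forall v w, edge v w -> deg w = ordS (deg v).
Proof.
case: n => // n _ nD; have [h hP] := exists_potential.
have modK v : (absz (h v %% n.+1)%Z)%:Z = (h v %% n.+1)%Z.
  by rewrite gez0_abs // modz_ge0.
have mod_lt v : (absz (h v %% n.+1)%Z < n.+1)%N.
  by rewrite -ltz_nat modK ltz_pmod.
exists (fun v => Ordinal (mod_lt v)) => v w /hP/(dvdn_trans nD) e.
apply/val_inj => /=; apply/eqP; rewrite -eqz_nat modK -modz_nat.
by rewrite -[(absz _).+1]addn1 PoszD modK modzDml eq_sym eqz_mod_dvd.
Qed.

End Degree.

(** * Pure tensors and the decomposition of [tensor A D] along the natural basis of [D] *)

Section TensorMaps.
Variable K : fieldType.
Implicit Types A B C D : natEvAlg K.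

(** Compare the matrix entries in a column [j] where [c] has a nonzero coordinate: [a] is [b] times
    the ratio of the [j]-th coordinates of [d] and [c]. *)
Lemma tens_linel A C (a b : A) (c d : C) :
  c != 0 -> tens a c = tens b d -> a \in <[b]>%VS.
Proof.
move=> c0 /matrixP e.
have [j cj] : exists j, coord (vbasis fullv) j c != 0.
  apply/existsP; apply: contraR c0; rewrite negb_exists => /forallP z.
  rewrite (coord_vbasis (memvf c)) big1 // => i _.
  by have /negPn/eqP-> := z i; rewrite scale0r.
apply/vlineP; exists (coord (vbasis fullv) j d / coord (vbasis fullv) j c).
rewrite (coord_vbasis (memvf a)) (coord_vbasis (memvf b)) scaler_sumr.
apply: eq_bigr => i _; rewrite scalerA; congr (_ *: _).
have := e i j; rewrite !mxE => eij.
by apply: (mulIf cj); rewrite eij mulrAC divfK // mulrC.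
Qed.

Lemma tens_injl A C (c : C) : c != 0 -> injective (fun a : A => tens a c).
Proof.
move=> c0 a b /eqP; rewrite -subr_eq0 -(linearBl (@tens K A C)) => ab0.
apply/eqP; rewrite -subr_eq0; apply: contraTT ab0 => ab.
exact: tens_neq0.
Qed.

Lemma tens_vline A C (a b : A) (c : C) : (<[a]> = <[b]>)%VS ->
  (<[tens a c : tensor A C]> = <[tens b c : tensor A C]>)%VS.
Proof.
have sub (u v : A) : u \in <[v]>%VS -> tens u c \in <[tens v c : tensor A C]>%VS.
  by case/vlineP=> k ->; rewrite bilinearZl memvZ ?memv_line.
move=> ab; apply/eqP; rewrite eqEsubv -!memvE.
by apply/andP; split; apply: sub; rewrite (ab, esym ab) memv_line.
Qed.

(* [id ⊗ l], read in the coordinates defining [tensor_space]. *)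
Definition contract A C (l : C -> K) (x : tensor A C) : A :=
  \sum_i \sum_j ((x : tensor_space A C) i j * l (vbasis fullv)`_j) *:
    (vbasis fullv)`_i.

Lemma contract_is_linear A C (l : C -> K) : linear (@contract A C l).
Proof.
move=> k x y; rewrite /contract scaler_sumr -big_split; apply: eq_bigr => i _ /=.
rewrite scaler_sumr -big_split; apply: eq_bigr => j _ /=.
by rewrite !mxE scalerA -scalerDl mulrA -mulrDl.
Qed.
HB.instance Definition _ A C l := GRing.isLinear.Build K (tensor A C) A *:%R
  (@contract A C l) (@contract_is_linear A C l).

Lemma contract_tens A C (l : {scalar C}) a c :
  @contract A C l (tens a c) = l c *: a.
Proof.
rewrite {2}(coord_vbasis (memvf a)) {2}(coord_vbasis (memvf c)) scaler_sumr.
apply: eq_bigr => i _; rewrite linear_sum scaler_suml; apply: eq_bigr => j _.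
by rewrite !mxE scalarZ scalerA; congr (_ *: _); rewrite [RHS]mulrC mulrA.
Qed.

(** Contraction against the dual natural basis: the coefficient in [A] of the summand [A ⊗ d_r]. *)
Definition component A D (r : lindex D) : tensor A D -> A :=
  contract (coord (btuple D) (enum_rank r)).

HB.instance Definition _ A D r := GRing.Linear.on (@component A D r).

Lemma bcoef_bvec D (r s : lindex D) : bcoef r (bvec s) = (r == s)%:R.
Proof.
rewrite /bcoef.
have -> : bvec s = (btuple D)`_(enum_rank s).
  by rewrite nth_mktuple enum_rankK.
rewrite coord_free ?(basis_free (btuple_basis D)) //.
by rewrite (inj_eq enum_rank_inj) eq_sym.
Qed.

Lemma component_tens A D (r : lindex D) (a : A) d :
  component r (tens a d) = bcoef r d *: a.
Proof. exact: contract_tens. Qed.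

(** Both sides are linear in [x] and agree on pure tensors, among which are the matrix units, by
    [tens_delta]. *)
Lemma component_sum A D (x : tensor A D) :
  x = \sum_r tens (component r x) (bvec r).
Proof.
have tensE a (d : D) :
    tens a d = \sum_r tens (component r (tens a d)) (bvec r) :> tensor A D.
  rewrite {1}(bcoef_sum d) (linear_sumr (@tens K A D)).
  apply: eq_bigr => r _.
  by rewrite component_tens !(bilinearZl, bilinearZr).
have deltaE i j : delta_mx i j =
    \sum_r tens (component r (delta_mx i j : tensor_space A D)) (bvec r)
      :> tensor_space A D.
  by rewrite -tens_delta; exact: tensE.
rewrite [LHS](matrix_sum_delta (x : tensor_space A D)).
under eq_bigr do under eq_bigr do rewrite deltaE.
(* Expanding [x] inside each component as well makes the two sides match entry by entry once the
   sums are exchanged. *)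
under [RHS]eq_bigr => r _.
  rewrite [x in component r x](matrix_sum_delta (x : tensor_space A D)).
  rewrite linear_sum (linear_sumlz (@tens K A D)).
  under eq_bigr => i _.
    rewrite linear_sum (linear_sumlz (@tens K A D)).
    under eq_bigr do rewrite linearZ bilinearZl.
    over.
  over.
rewrite [RHS]exchange_big; apply: eq_bigr => i _ /=.
rewrite [RHS]exchange_big; apply: eq_bigr => j _ /=.
by rewrite scaler_sumr.
Qed.

(** * Maps acting separately on each block [A ⊗ d_r] *)

Section Blockwise.
Variables (A B D : natEvAlg K) (psi : lindex D -> 'Hom(A, B)).

Definition blockwise (x : tensor A D) : tensor B D :=
  \sum_r tens (psi r (component r x)) (bvec r).

Lemma blockwise_is_linear : linear blockwise.
Proof.
move=> k x y; rewrite /blockwise scaler_sumr -big_split; apply: eq_bigr => r _ /=.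
by rewrite !linearP (linearDl (@tens K B D)) bilinearZl.
Qed.
HB.instance Definition _ := GRing.isLinear.Build K (tensor A D) (tensor B D) *:%R
  blockwise blockwise_is_linear.

Lemma blockwise_tens a d :
  blockwise (tens a d) = \sum_r bcoef r d *: tens (psi r a) (bvec r).
Proof.
by apply: eq_bigr => r _; rewrite component_tens linearZ bilinearZl.
Qed.

(** Stated for every vector of the line, since relativity is tested on all its nonzero vectors and
    not only on [bvec r]. *)
Lemma blockwise_line r a d :
  d \in line D r -> blockwise (tens a d) = tens (psi r a) d.
Proof.
rewrite bvec_line => /vlineP[k ->]; rewrite !bilinearZr linearZ /=; congr (_ *: _).
rewrite blockwise_tens (bigD1 r) //= big1 => [|s sr].
  by rewrite bcoef_bvec eqxx scale1r addr0.
by rewrite bcoef_bvec (negPf sr) scale0r.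
Qed.

Lemma blockwise_bvec r a :
  blockwise (tens a (bvec r)) = tens (psi r a) (bvec r).
Proof. by apply: blockwise_line; rewrite bvec_line memv_line. Qed.

Lemma component_blockwise r x :
  component r (blockwise x) = psi r (component r x).
Proof.
rewrite linear_sum (bigD1 r) //= big1 => [|s sr].
  by rewrite component_tens bcoef_bvec eqxx scale1r addr0.
by rewrite component_tens bcoef_bvec eq_sym (negPf sr) scale0r.
Qed.

Lemma blockwise_inj : (forall r, injective (psi r)) -> injective blockwise.
Proof.
move=> psiI x y xy; rewrite (component_sum x) (component_sum y).
apply: eq_bigr => r _; congr (tens _ _); apply: (psiI r).
by rewrite -!component_blockwise xy.
Qed.

(** By bilinearity it suffices to multiply blocks. Distinct blocks annihilate each other, and the
    square of [bvec r] involves only the [bvec s] with an edge from [r] to [s], so compatibility of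
    [psi] along edges is enough. *)
Lemma blockwise_mul :
  (forall r s, edge r s ->
     forall a a', psi s (emul a a') = emul (psi r a) (psi r a')) ->
  forall x y : tensor A D, blockwise (emul x y) = emul (blockwise x) (blockwise y).
Proof.
move=> psiM x y.
have bE z : blockwise z = \sum_r tens (psi r (component r z)) (bvec r) by [].
rewrite {1}(component_sum x) {1}(component_sum y).
rewrite (linear_sumlz (@emul K (tensor A D))) linear_sum.
rewrite (bE x) (linear_sumlz (@emul K (tensor B D))).
apply: eq_bigr => r _; rewrite (linear_sumr (@emul K (tensor A D))) linear_sum.
rewrite (bE y) (linear_sumr (@emul K (tensor B D))).
apply: eq_bigr => s _; rewrite [in RHS]/= [in LHS]/= !tens_mul.
have [<-{s}|rs] := eqVneq r s; last first.
  by rewrite !bvec_orth // !(linear0r (@tens K _ D)) linear0.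
set a := component r x; set a' := component r y.
rewrite blockwise_tens [in RHS](bcoef_sum (emul (bvec r) (bvec r))).
rewrite (linear_sumr (@tens K B D)); apply: eq_bigr => s _; rewrite bilinearZr.
have [e|/negPn/eqP->] := boolP (edge r s); last by rewrite !scale0r.
by rewrite (psiM r s e).
Qed.

End Blockwise.

(** * A criterion for isomorphism of natural evolution algebras *)

Lemma line_inj (X : natEvAlg K) : injective (line X).
Proof.
move=> i j ij; apply/eqP; have := bcoef_bvec i j.
have : bvec i \in line X j by rewrite -ij bvec_line memv_line.
rewrite bvec_line => /vlineP[k ik].
(* The coordinate at [i] is 1 on [bvec i], but would vanish on a multiple of [bvec j] if [j]
   differed from [i]. *)
have := bcoef_bvec i i; rewrite ik eqxx /bcoef linearZ /= -/(bcoef _ _) bcoef_bvec.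
by case: eqP => // _ /eqP; rewrite mulr0 eq_sym oner_eq0.
Qed.

(** The linear inverse respects lines by counting: [f] induces an injection between the sets of
    lines, which have equal cardinality because the dimensions agree, so every line of [Y] is the
    image of a line of [X]. *)
Lemma inj_morphism_iso (X Y : natEvAlg K) (f : 'Hom(X, Y)) :
  nea_morphism f -> injective f -> \dim {:X} = \dim {:Y} -> nea_iso f.
Proof.
move=> fm fI dXY; split=> //.
have kf : lker f == 0%VS by apply/lker0P.
have fK : cancel f (f^-1)%VF by apply: lker0_lfunK.
have gK : cancel (f^-1)%VF f.
  move=> y; apply: limg_lfunVK; suff -> : limg f = fullv by exact: memvf.
  by apply/eqP; rewrite eqEdim subvf /= limg_dim_eq ?dXY // (eqP kf) capv0.
exists (f^-1)%VF; split=> //; have [fM fL] := fm; split=> [x y|j].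
  by apply: fI; rewrite fM !gK.
split; first by move=> x y _ _; apply: can_inj gK _ _.
have /boolp.choice[s sE] i : exists j, (f @: line X i)%VS = line Y j := (fL i).2.
have imgK U : (f^-1 @: (f @: U))%VS = U.
  rewrite -limg_comp (_ : _ \o _ = \1)%VF ?lim1g //.
  by apply/lfunP=> x; rewrite comp_lfunE id_lfunE fK.
have sI : injective s.
  by move=> i i' e; apply: line_inj; rewrite -(imgK (line X i)) sE e -sE imgK.
have [] := inj_card_bij sI; first by rewrite -!card_lindex dXY.
by move=> t _ tK; exists (t j); rewrite -[RHS]imgK sE tK.
Qed.

End TensorMaps.

(** * Extracting the family [psi] from a relative isomorphism over the cyclic algebra *)

Section CyclicRelative.
Variable K : fieldType.

Lemma iso_dim (X Y : natEvAlg K) (f : 'Hom(X, Y)) :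
  nea_iso f -> \dim {:X} = \dim {:Y}.
Proof.
have le (U V : natEvAlg K) (h : 'Hom(U, V)) : injective h ->
    (\dim {:U} <= \dim {:V})%N.
  move/lker0P => kh; rewrite -(limg_dim_eq (f := h)) ?dimvS ?subvf //.
  by rewrite (eqP kh) capv0.
case=> _ [g [_ fK gK]]; apply/eqP.
by rewrite eqn_leq (le _ _ f (can_inj fK)) (le _ _ g (can_inj gK)).
Qed.

(** Multiplicativity comes from applying [phi] to [(a ⊗ c_i)(a' ⊗ c_i) = aa' ⊗ c_{i+1}] and
    cancelling the nonzero factor [c_{i+1}]. *)
Lemma iso_relative_cyclic (A B : natEvAlg K) n : (0 < n)%N ->
  iso_relative A B (cyclic_alg K n) ->
  \dim {:A} = \dim {:B} /\
  exists psi : 'I_n -> 'Hom(A, B),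
    [/\ forall i, injective (psi i),
        forall i a a', psi (ordS i) (emul a a') = emul (psi i a) (psi i a')
      & forall i k, exists j, (psi i @: line A k)%VS = line B j].
Proof.
move=> n0 [phi [phi_iso rel]]; set C := cyclic_alg K n in phi phi_iso rel.
split.
  have := iso_dim phi_iso; rewrite !dim_tensor dim_cyclic card_ord => /eqP.
  by rewrite eqn_pmul2r // => /eqP.
have c0 (i : 'I_n) : (cyclic_vec K i : C) != 0 := cyclic_vec_neq0 K i.
have /boolp.choice[psi psiE] (i : 'I_n) : exists psi : 'Hom(A, B),
    forall a : A,
      phi (tens a (cyclic_vec K i : C)) = tens (psi a) (cyclic_vec K i : C).
  by apply: (rel i); [exact: memv_line|exact: c0].
have [[phiM phiL] [g [_ phiK _]]] := phi_iso.
have psiI i : injective (psi i).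
  move=> a b ab; apply: (tens_injl (c0 i)); apply: (can_inj phiK).
  by rewrite !psiE ab.
exists psi; split=> // [i a a'|i k].
  apply: (tens_injl (c0 (ordS i))) => /=.
  have cE : (cyclic_vec K (ordS i) : C) =
      emul (cyclic_vec K i : C) (cyclic_vec K i : C).
    by rewrite /= cyclic_sqr.
  rewrite -psiE cE -!tens_mul -!psiE; exact: phiM.
have [_ [[j r] jE]] := phiL (k, i).
have : phi (tens (bvec k) (bvec (i : lindex C))) \in line (tensor B C) (j, r).
  by rewrite -jE; apply/memv_img/memv_line.
(* [psi] is defined through [cyclic_vec], whereas [bvec] is an arbitrary nonzero vector of the same
   line; the scalar [c] translates between them. *)
have [c] : exists c, bvec (i : lindex C) = c *: (cyclic_vec K i : C).
  by apply/vlineP; exact: memv_pick.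
move=> cE; have nz := bvec_neq0 (i : lindex C).
rewrite {1}cE bilinearZr linearZ /= psiE.
rewrite -(bilinearZr (@tens K B C)) -cE => /vlineP[l].
rewrite /= /tensor_bvec /= -(bilinearZr (@tens K B C)) => /(tens_linel nz) kj.
(* The image of the line lies in line [j], and it equals it because injectivity of [psi i] keeps its
   dimension 1. *)
exists j; apply/eqP; rewrite bvec_line limg_line (bvec_line j) eqEdim.
rewrite -memvE kj !dim_vline bvec_neq0.
by rewrite -(linear0 (psi i)) (inj_eq (psiI i)) bvec_neq0.
Qed.

End CyclicRelative.

Local Close Scope ring_scope.

Theorem theorem10p4 (K : fieldType) (A B D : natEvAlg K)
  (indecD : indecomposable D) (balD : 1 < balance D)
  (n : nat) (n_gt0 : 0 < n) (n_dvd : n %| balance D)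
  (isoC : iso_relative A B (cyclic_alg K n)) :
  iso_relative A B D.
Proof.
have [dAB [psi [psiI psiM psiL]]] := iso_relative_cyclic n_gt0 isoC.
have [deg degP] := exists_degree n_gt0 n_dvd.
(* Along an edge from [r] to [s], the degree of [s] is [ordS (deg r)], so [psiM] is exactly what
   [blockwise_mul] requires. *)
pose f := blockwise (fun r : lindex D => psi (deg r)).
have fI : injective f by apply: blockwise_inj => r.
exists (linfun f); split; last first.
  move=> r d dr _; exists (psi (deg r)) => a.
  by rewrite lfunE /= (blockwise_line _ _ dr).
apply: inj_morphism_iso; last by rewrite !dim_tensor dAB.
  split=> [x y|[k r]].
    by rewrite !lfunE; apply: blockwise_mul => r s /degP->.
  split; first by move=> x y _ _; rewrite !lfunE; apply: fI.
  (* Only the index in [A] moves, by the permutation of lines that [psi (deg r)] induces; the index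
     [r] in [D] is fixed. *)
  have [j jE] := psiL (deg r) k; exists (j, r).
  rewrite limg_line lfunE /= blockwise_bvec.
  by apply: tens_vline; rewrite -limg_line -!bvec_line.
by move=> x y; rewrite !lfunE; apply: fI.
Qed.
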